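(* For all integers $r,n\ge 0$ there is a bijection $\phi^{\mathrm{fix}}:D_n^*(r)\to W_n(r)$, $(w_0,(w_1,i_1),\dots,(w_m,i_m))\mapsto w$, such that $$i_1+\cdots+i_m=\mathrm{dec}\,w,\qquad i_1+\cdots+i_m+\mathrm{tot}\,w_0+\mathrm{tot}\,w_1+\cdots+\mathrm{tot}\,w_m=\mathrm{tot}\,w,\qquad \lambda w_0=\mathrm{single}\,w.$$
   Context: $W_n(r)=\{0,1,\dots,r\}^n$ is the set of words of length $n$ over $\{0,\dots,r\}$. For a word $c=c_1\cdots c_n$ of nonnegative integers, $\lambda c=n$ and $\mathrm{tot}\,c=c_1+\cdots+c_n$. $\mathrm{NIW}(r)$ is the set of nonincreasing words (any length $\ge0$) with letters in $\{0,\dots,r\}$. $D(r)$ is the set of pairs $(w,i)$ with $w\in\mathrm{NIW}(r-1)$, $\lambda w\ge2$, $1\le i\le\lambda w-1$. $D_n^*(r)$ is the set of sequences $(w_0,(w_1,i_1),\dots,(w_m,i_m))$, $m\ge0$, with $w_0\in\mathrm{NIW}(r)$, each $(w_j,i_j)\in D(r)$, and $\lambda w_0+\cdots+\lambda w_m=n$. Decreases: for $w=x_1\cdots x_n$, an index $i$ with $1\le i\le n-1$ is a decrease if $x_i\ge x_{i+1}\ge\cdots\ge x_j>x_{j+1}$ for some $j$ with $i\le j\le n-1$; $\mathrm{dec}\,w$ is the number of decreases. Lyndon factorization: a nonempty word $x_1\cdots x_n$ is Lyndon if $n=1$ or it is lexicographically strictly greater than each of its proper cyclic rotations $x_i\cdots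 x_nx_1\cdots x_{i-1}$, $2\le i\le n$. For primitive nonempty words, $w\preceq w'$ means $w^b\le w'^b$ lexicographically for all sufficiently large $b$. Every nonempty word factors uniquely as $l_1l_2\cdots l_k$ with Lyndon words $l_1\preceq l_2\preceq\cdots\preceq l_k$; $\mathrm{single}\,w$ is the number of factors $l_i$ of length one (and $\mathrm{single}$ of the empty word is $0$). *)

(* Defs.v *)
From mathcomp Require Import all_boot all_order.
From mathcomp Require Import boolp classical_sets.
Set Implicit Arguments.
Unset Strict Implicit.
Unset Printing Implicit Defensive.

Definition word := seq nat.

Definition tot (w : word) : nat := sumn w.

Definition words (r n : nat) : Type :=
  {w : word | (size w == n) && all (fun x => x <= r) w}.

(* The letters are bounded strictly by k, so that NIW(r) is [niw r.+1] and
   NIW(r-1) is [niw r]. This includes r = 0, where NIW(-1) consists of the empty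
   word only; [niw] with the bound r.-1 would be wrong there. *)
Definition niw (k : nat) : pred word :=
  fun w => sorted geq w && all (fun x => x < k) w.

Definition marked_niw (r : nat) : pred (word * nat) :=
  fun p => [&& niw r p.1, 1 < size p.1, 0 < p.2 & p.2 <= (size p.1).-1].

(* D_n^*(r): the pair (w0, [:: (w1, i1); ...; (wm, im)]) encodes the sequence
   (w0, (w1, i1), ..., (wm, im)). *)
Definition Dstar (r n : nat) : Type :=
  {d : word * seq (word * nat) |
    [&& niw r.+1 d.1, all (marked_niw r) d.2
      & size d.1 + \sum_(p <- d.2) size p.1 == n]}.

(* Positions are counted from 0: position i is the index i + 1 of the usual
   1-based convention, and ranges over 0, ..., size w - 2. *)
Definition decrease (w : word) (i : 'I_(size w).-1) : bool :=
  [exists j : 'I_(size w).-1,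
    [&& i <= j,
        [forall k : 'I_(size w).-1,
          (i <= k < j) ==> (nth 0 w k.+1 <= nth 0 w k)]
      & nth 0 w j.+1 < nth 0 w j]].

Definition dec (w : word) : nat := #|[set i | decrease (w := w) i]|.

(* Lexicographic order on words; a proper prefix is smaller. *)
Definition lex_le (u v : word) : bool :=
  ((u : seqlexi nat) <= (v : seqlexi nat))%O.
Definition lex_lt (u v : word) : bool :=
  ((u : seqlexi nat) < (v : seqlexi nat))%O.

(* The condition on rotations is vacuous for words of length 1. *)
Definition lyndon (w : word) : bool :=
  (w != [::]) && [forall i : 'I_(size w), (0 < i) ==> lex_lt (rot i w) w].

Definition wpow (w : word) (b : nat) : word := flatten (nseq b w).

Definition preceq (u v : word) : bool :=
  `[< exists B, forall b, B <= b -> lex_le (wpow u b) (wpow v b) >].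

Definition lyndon_factorization (w : word) (ls : seq word) : Prop :=
  [/\ flatten ls = w, all lyndon ls & sorted preceq ls].

(* The Lyndon factorization exists and is unique, so the default value [::] and
   the choice made by [xget] play no role. For the empty word it is [::]. *)
Definition lyndon_factors (w : word) : seq word :=
  xget [::] (lyndon_factorization w : set (seq word)).

Definition single (w : word) : nat :=
  count (fun l => size l == 1) (lyndon_factors w).

(* Main.v *)
(* The bijection is a transducer reading a word from right to left. Its state is
   (h, s), where h lists in increasing order the letters of the word read so far
   that are weak left-to-right maxima but not decreases, and s is a sequence of
   marked words. A new letter a that is not a decrease is added to h. If a is a
   decrease, the letters of h below a, say h', stop being left-to-right maxima: if
   there are any, they form with a - 1 a new marked word with mark 1 at the head of
   s; otherwise a - 1 is put in front of the first word of s, whose mark grows by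
   one. Every step can be undone, since the letter last read is the smaller one of
   the head of h and of the first letter plus one of s (h having priority only when
   strictly smaller). Finally single w is the length of h: in a Lyndon factorization,
   a factor of length at least two begins with a letter exceeding its last letter,
   so all its left-to-right maxima are decreases, and the factors of length one are
   never followed by a smaller letter before a larger one. *)
Require Import Defs.
From mathcomp Require Import all_boot all_order.
From mathcomp Require Import boolp classical_sets zify.
Set Implicit Arguments.
Unset Strict Implicit.
Unset Printing Implicit Defensive.
Import Order.TTheory.

(** * Decreases and a recursion for [dec] *)

(* Whether the letter a is a decrease in the word a :: u. *)
Fixpoint decr (a : nat) (u : word) : bool :=
  if u is b :: u' then (b < a) || (b == a) && decr b u' else false.

Lemma decrP (a : nat) (u : word) :
  reflect (exists j, [/\ j < size u,
                forall k, k < j -> nth 0 (a :: u) k.+1 <= nth 0 (a :: u) k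
                & nth 0 (a :: u) j.+1 < nth 0 (a :: u) j])
          (decr a u).
Proof.
apply: (iffP idP).
- elim: u a => [//|b u IH] a /= /orP[lt_ba|/andP[/eqP-> /IH[j [lt_j le_j gt_j]]]].
    by exists 0.
  by exists j.+1; split=> // -[|k] //= lt_kj; apply: le_j.
- elim: u a => [|b u IH] a [j [//= lt_j le_j gt_j]].
  case: j lt_j le_j gt_j => [|j] lt_j le_j gt_j; first by rewrite /= in gt_j; rewrite gt_j.
  have := le_j 0 isT; rewrite /= leq_eqVlt => /orP[/eqP eq_ba|->//].
  rewrite eq_ba ltnn eqxx /= -eq_ba; apply: IH; exists j; split=> // k lt_kj.
  exact: (le_j k.+1).
Qed.

Lemma decrease_decr (w : word) (i : 'I_(size w).-1) :
  decrease i = decr (nth 0 w i) (drop i.+1 w).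
Proof.
have lt_iw : i < size w by have := ltn_ord i; lia.
have nthE k : nth 0 (nth 0 w i :: drop i.+1 w) k = nth 0 w (i + k).
  by rewrite -drop_nth // nth_drop.
apply/existsP/decrP => [[j /and3P[le_ij /forallP le_j gt_j]]|[j [lt_j le_j gt_j]]].
- exists (j - i); split=> [|k lt_kj|].
  + by rewrite size_drop; have := ltn_ord j; lia.
  + rewrite !nthE addnS.
    have lt_kw : i + k < (size w).-1 by have := ltn_ord j; lia.
    have /implyP := le_j (Ordinal lt_kw); apply=> /=; lia.
  + by rewrite !nthE addnS subnKC.
- rewrite size_drop in lt_j.
  have lt_jw : i + j < (size w).-1 by lia.
  exists (Ordinal lt_jw); apply/and3P; split=> /=; first by lia.
  + apply/forallP=> k; apply/implyP=> /andP[le_ik lt_kj].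
    have lt_kij : k - i < j by lia.
    by have := le_j _ lt_kij; rewrite !nthE addnS subnKC.
  + by move: gt_j; rewrite !nthE addnS.
Qed.

Lemma dec_sum (w : word) :
  dec w = \sum_(i < (size w).-1) decr (nth 0 w i) (drop i.+1 w).
Proof.
rewrite /dec -sum1dep_card big_mkcond; apply: eq_bigr => i _.
by rewrite decrease_decr; case: decr.
Qed.

Lemma dec_nil : dec [::] = 0.
Proof. by rewrite dec_sum big_ord0. Qed.

Lemma dec_cons (a : nat) (u : word) : dec (a :: u) = decr a u + dec u.
Proof.
rewrite !dec_sum; case: u => [|b u] /=; first by rewrite !big_ord0.
by rewrite big_ord_recl.
Qed.

(* The letters that are weak left-to-right maxima but not decreases. *)
Fixpoint singles (w : word) : word :=
  if w is a :: u then
    if decr a u then [seq x <- singles u | a <= x] else a :: singles u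
  else [::].

(** * Comparison of words at their first difference *)

(* At the first position where u and v differ, both are defined and u is greater. *)
Fixpoint gtd (u v : word) : bool :=
  match u, v with
  | a :: u', b :: v' => (b < a) || (a == b) && gtd u' v'
  | _, _ => false
  end.

Lemma gtd_cat (u v x y : word) : gtd u v -> gtd (u ++ x) (v ++ y).
Proof.
by elim: u v => [|a u IH] [|b v] //= /orP[->//|/andP[-> /IH->]]; rewrite orbT.
Qed.

Lemma gtd_cat2l (x u v : word) : gtd (x ++ u) (x ++ v) = gtd u v.
Proof. by elim: x => //= a x ->; rewrite ltnn eqxx. Qed.

Lemma gtd_prefix (u v : word) : prefix v u -> gtd u v = false.
Proof.
elim: u v => [|a u IH] [|b v] //= /andP[/eqP-> /IH->].
by rewrite ltnn eqxx.
Qed.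

Lemma gtd_total (u v : word) : [|| gtd u v, gtd v u, prefix u v | prefix v u].
Proof.
elim: u v => [|a u IH] [|b v] //=.
have := IH v; rewrite (eq_sym b a).
by case: (ltngtP a b) => //= ->; rewrite eqxx.
Qed.

Lemma gtd_catl (v z t : word) : gtd (v ++ z) t -> prefix v t || gtd v t.
Proof.
elim: v t => [|a v IH] [|b t] //= /orP[->|/andP[/eqP-> /IH]]; rewrite ?orbT //.
by rewrite eqxx ltnn.
Qed.

Lemma gtd_trans (u v x : word) : gtd u v -> gtd v x -> gtd u x.
Proof.
elim: u v x => [|a u IH] [|b v] [|c x] //=.
move=> /orP[lt_ba|/andP[/eqP-> gt_uv]] /orP[lt_cb|/andP[/eqP eq_bc gt_vx]].
- by rewrite (ltn_trans lt_cb lt_ba).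
- by rewrite -eq_bc lt_ba.
- by rewrite lt_cb.
- by rewrite eq_bc eqxx (IH _ _ gt_uv gt_vx) orbT.
Qed.

Lemma lex_lt_cons (a b : nat) (u v : word) :
  lex_lt (a :: u) (b :: v) = (a < b) || (a == b) && lex_lt u v.
Proof. by rewrite /lex_lt ltxi_cons !leEnat; case: (ltngtP a b). Qed.

Lemma lex_le_cons (a b : nat) (u v : word) :
  lex_le (a :: u) (b :: v) = (a < b) || (a == b) && lex_le u v.
Proof. by rewrite /lex_le lexi_cons !leEnat; case: (ltngtP a b). Qed.

Lemma gtd_lex_lt (u v : word) : gtd u v -> lex_lt v u.
Proof.
elim: u v => [|a u IH] [|b v] //=; rewrite lex_lt_cons eq_sym.
by move=> /orP[->//|/andP[-> /IH->]]; rewrite orbT.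
Qed.

Lemma gtd_lex_le (u v : word) : gtd u v -> lex_le v u.
Proof. by move/gtd_lex_lt; rewrite /lex_lt /lex_le; apply: ltW. Qed.

Lemma wpowS (u : word) (b : nat) : wpow u b.+1 = u ++ wpow u b.
Proof. by []. Qed.

Lemma wpowD (u : word) (b c : nat) : wpow u (b + c) = wpow u b ++ wpow u c.
Proof. by rewrite /wpow nseqD flatten_cat. Qed.

(** * Lyndon words and their singles *)

Lemma preceq_head (u v : word) :
  u != [::] -> v != [::] -> preceq u v -> head 0 u <= head 0 v.
Proof.
case: u v => [|a u] [|b v] // _ _ /asboolP[B /(_ B.+1 (leqnSn B))].
by rewrite !wpowS /= lex_le_cons => /orP[/ltnW//|/andP[/eqP->]].
Qed.

Lemma lyndon_all_le (a : nat) (l : word) :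
  lyndon (a :: l) -> all (fun x => x <= a) l.
Proof.
move=> /andP[_ /forallP rot_lt]; apply/(all_nthP 0) => i lt_i.
have lt_i1 : i.+1 < size (a :: l) by [].
have := rot_lt (Ordinal lt_i1); rewrite /rot /= (drop_nth 0) //= lex_lt_cons.
by move=> /orP[/ltnW//|/andP[/eqP->]].
Qed.

Lemma lex_lt_shift (a : nat) (m : word) :
  all (fun x => x <= a) m -> lex_lt (a :: m) (rcons m a) = false.
Proof.
elim: m => [|b m IH] /=; first by rewrite /lex_lt ltxx.
move=> /andP[le_ba /IH lt_m]; rewrite lex_lt_cons ltnNge le_ba /=.
by case: eqP => // <-.
Qed.

(** If the last letter were [a] too, moving it to the front would give a rotation not smaller than
    the word, since [a] is its largest letter. *)
Lemma lyndon_last_lt (a : nat) (l : word) :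
  lyndon (a :: l) -> l != [::] -> last a l < a.
Proof.
move=> lyn_l; have := lyndon_all_le lyn_l.
case/lastP: l lyn_l => [//|m b] lyn_l; rewrite all_rcons last_rcons => /andP[le_ba le_m] _.
rewrite ltn_neqAle le_ba andbT; apply/eqP=> eq_ba; subst b.
move: lyn_l => /andP[_ /forallP rot_lt].
have lt_m : (size m).+1 < size (a :: rcons m a) by rewrite /= size_rcons.
have := rot_lt (Ordinal lt_m); rewrite /= -rcons_cons -cats1.
rewrite -[(size m).+1]/(size (a :: m)) rot_size_cat /= cats1.
by rewrite lex_lt_cons ltnn eqxx /= lex_lt_shift.
Qed.

Lemma lex_le_nseq (a b : nat) (y z : word) :
  all (fun x => x <= a) y -> has (fun x => x < a) y -> size y <= b ->
  lex_le (nseq b a) (y ++ z) = false.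
Proof.
elim: y b => [//|c y IH] [//|b] /= /andP[le_ca le_y] lt_y le_b.
rewrite lex_le_cons ltnNge le_ca /=; case: eqP lt_y => //= <-.
by rewrite ltnn => /= ?; apply: IH.
Qed.

Lemma wpow1 (u : word) : wpow u 1 = u.
Proof. exact: cats0. Qed.

Lemma wpowSr (u : word) (b : nat) : wpow u b.+1 = wpow u b ++ u.
Proof. by rewrite -addn1 wpowD wpow1. Qed.

Lemma wpow_letter (a b : nat) : wpow [:: a] b = nseq b a.
Proof. by elim: b => //= b <-. Qed.

Lemma preceq_single (a b : nat) (l : word) :
  lyndon (b :: l) -> l != [::] -> preceq [:: a] (b :: l) -> a < b.
Proof.
move=> lyn_l l_nil ab; have /(_ isT isT) := preceq_head _ _ ab; rewrite /= leq_eqVlt.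
case/orP=> // /eqP eq_ab; subst b; case/asboolP: ab => B.
(* The exponent exceeds the threshold [B], and its run of letters [a] covers a whole copy of
   [a :: l], whose last letter is below [a]. *)
have le_B : B <= (B + size (a :: l)).+1 by lia.
move=> /(_ _ le_B); rewrite wpow_letter wpowS lex_le_nseq //=; last by lia.
- by rewrite leqnn (lyndon_all_le lyn_l).
- apply/orP; right; apply/hasP; exists (last a l); last exact: lyndon_last_lt.
  by case: l l_nil {lyn_l le_B} => //= c l _; apply: mem_last.
Qed.

Lemma decr_cat (a : nat) (y v : word) :
  y != [::] -> all (fun x => x <= a) y -> last a y < a -> decr a (y ++ v).
Proof.
elim: y => [//|b y IH] _ /= /andP[le_ba le_y] last_lt.
case: (ltngtP b a) le_ba => //= eq_ba _; subst b.
by apply: IH => //; apply: contraTneq last_lt => ->; rewrite ltnn.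
Qed.

(** A letter of [y] equal to [a] is a decrease because [y] ends below [a], so only smaller letters
    of [y] can survive; filtering by a letter of [y] leaves [singles v] intact. *)
Lemma singles_cat (a : nat) (y v : word) :
    all (fun x => x <= a) y -> last a y < a -> all (leq a) (singles v) ->
  exists2 x, singles (y ++ v) = x ++ singles v & all (fun b => b < a) x.
Proof.
move=> le_y last_y ge_v; elim: y le_y last_y => [|b y IH] /=; first by exists [::].
move=> /andP[le_ba le_y].
case: (eqVneq y [::]) => [->{IH le_y}/= lt_ba|y_nil last_y].
  case: ifP => _; last by exists [:: b]; rewrite //= lt_ba.
  exists [::] => //=; rewrite (all_filterP _) //.
  by apply: sub_all ge_v => x; apply/leq_trans/ltnW.
have last_ya : last a y < a by case: (y) y_nil last_y.
have [x -> lt_x] := IH le_y last_ya.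
case: ifP => [_|ndecr].
  exists [seq c <- x | b <= c]; last by rewrite all_filter; apply: sub_all lt_x => c /= ->; rewrite implybT.
  rewrite filter_cat; congr (_ ++ _); apply/all_filterP.
  by apply: sub_all ge_v => c; apply: leq_trans.
exists (b :: x) => //=; rewrite lt_x andbT ltn_neqAle le_ba andbT.
apply: contraFneq ndecr => eq_ba; subst b; exact: decr_cat.
Qed.

(** The first letter [a] is itself a decrease, and its filter removes exactly the smaller letters
    that [l] contributed. *)
Lemma singles_lyndon (a : nat) (l v : word) :
    lyndon (a :: l) -> l != [::] -> all (leq a) (singles v) ->
  singles (a :: l ++ v) = singles v.
Proof.
move=> lyn_l l_nil ge_v /=; have le_l := lyndon_all_le lyn_l.
have last_l := lyndon_last_lt lyn_l l_nil.
rewrite decr_cat //; have [x -> lt_x] := singles_cat le_l last_l ge_v.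
rewrite filter_cat (all_filterP ge_v) -[RHS]cat0s; congr (_ ++ _).
by apply/eqP; rewrite -[_ == _]negbK -has_filter -all_predC; apply: sub_all lt_x => b /=; rewrite ltnNge.
Qed.

Lemma singles_lyndon_factorization (w : word) (ls : seq word) :
  lyndon_factorization w ls ->
  singles w = flatten [seq l <- ls | size l == 1].
Proof.
case=> <-{w} lyn_ls sorted_ls.
(* The induction also carries a lower bound on the singles: first letters of factors weakly
   increase, which yields the last hypothesis of [singles_lyndon]. *)
suff [-> //] : singles (flatten ls) = flatten [seq l <- ls | size l == 1] /\
   all (leq (head 0 (head [::] ls))) (singles (flatten ls)).
elim: ls lyn_ls sorted_ls => [//|l ls IH] /= /andP[lyn_l lyn_ls] sorted_ls.
have [eq_ls ge_ls] := IH lyn_ls (path_sorted sorted_ls).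
case: l lyn_l sorted_ls => [|a l] //= lyn_l sorted_ls.
have {}ge_ls : all (leq a) (singles (flatten ls)).
  case: ls lyn_ls sorted_ls ge_ls {IH eq_ls} => [//|m ls] /= /andP[lyn_m _] /andP[lm _].
  apply: sub_all => b; apply: leq_trans; apply: (preceq_head _ _ lm) => //.
  by case/andP: lyn_m.
case: (eqVneq l [::]) => [l_nil|l_nil]; last first.
  by have := singles_lyndon lyn_l l_nil ge_ls; case: l l_nil {lyn_l sorted_ls} => //= b l _ ->.
rewrite {}l_nil /= in lyn_l sorted_ls *.
(* After a one-letter factor comes a run of copies of it, then the end or a larger letter: a longer
   factor starts strictly higher by [preceq_single]. *)
suff -> : decr a (flatten ls) = false by rewrite /= eq_ls leqnn -eq_ls ge_ls.
elim: ls lyn_ls sorted_ls {IH eq_ls ge_ls} => [//|m ls IH] /= /andP[lyn_m lyn_ls] /andP[am sorted_ls].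
case: m lyn_m am sorted_ls => [//|b m] lyn_m am sorted_ls /=.
case: (eqVneq m [::]) => [m_nil|m_nil]; last first.
  by rewrite ltnNge; have lt_ab := preceq_single lyn_m m_nil am; rewrite gtn_eqF // (ltnW lt_ab).
subst m; have /(_ isT isT) /= := preceq_head _ _ am; rewrite ltnNge => -> //=.
by case: eqP => //= eq_ba; subst b; apply: IH.
Qed.

Lemma size_singles (w : word) (ls : seq word) :
  lyndon_factorization w ls ->
  size (singles w) = count (fun l => size l == 1) ls.
Proof.
move/singles_lyndon_factorization->; rewrite size_flatten /shape.
rewrite -size_filter; elim: ls => //= l ls; case: eqP => //= ->.
by rewrite add1n => ->.
Qed.

(** * Existence of the Lyndon factorization *)

(* The usual characterization of Lyndon words by suffixes instead of rotations,
   for the order on words opposite to that of the letters. *)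
Definition suffix_dominant (l : word) : Prop :=
  l != [::] /\ forall i, 0 < i < size l -> gtd l (drop i l).

Lemma suffix_dominant_lyndon (l : word) : suffix_dominant l -> lyndon l.
Proof.
case=> l_nil gt_l; rewrite /lyndon l_nil /=; apply/forallP=> i; apply/implyP=> i_gt0.
apply: gtd_lex_lt; rewrite -[l in gtd l _]cats0; apply: gtd_cat.
by apply: gt_l; rewrite i_gt0 /=.
Qed.

(** The last hypothesis puts [u] before [v] in the lexicographic order with reversed letters. It
    makes [u ++ v] dominate [v], through dominance of [v] if [u] is a prefix; suffixes starting
    inside [v] follow by transitivity, longer ones from dominance of [u]. *)
Lemma suffix_dominant_cat (u v : word) :
    suffix_dominant u -> suffix_dominant v ->
    gtd u v || prefix u v && (u != v) ->
  suffix_dominant (u ++ v).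
Proof.
move=> [u_nil gt_u] [v_nil gt_v] lt_uv.
have u_gt0 : 0 < size u by rewrite lt0n size_eq0.
have gt_uv : gtd (u ++ v) v.
  case/orP: lt_uv => [|/andP[/prefixP[v' eq_v]]].
    by move=> /(gtd_cat v [::]); rewrite cats0.
  subst v; rewrite gtd_cat2l => neq_uv.
  have v'_gt0 : 0 < size v'.
    by rewrite lt0n size_eq0; apply: contraNneq neq_uv => ->; rewrite cats0.
  by have := gt_v (size u); rewrite drop_size_cat //; apply; rewrite size_cat u_gt0 -{1}[size u]addn0 ltn_add2l.
split=> [|i /andP[i_gt0]]; first by case: (u) u_nil.
rewrite size_cat drop_cat => lt_i; case: ltnP => [lt_iu|le_ui].
  by apply: gtd_cat; apply: gt_u; rewrite i_gt0.
case: (posnP (i - size u)) => [->|d_gt0]; first by rewrite drop0.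
by apply: (gtd_trans gt_uv); apply: gt_v; lia.
Qed.

(** The first difference lies inside the first copy of [u], so appending further copies on either
    side preserves it. *)
Lemma preceq_gtd (u v : word) (k : nat) :
  gtd (wpow v k) u -> preceq u v.
Proof.
move=> gt_vu; apply/asboolP; exists k.+1 => -[//|b] lt_kb; apply: gtd_lex_le.
by rewrite -(subnKC (ltnW lt_kb)) wpowD subnKC ?(ltnW lt_kb) // wpowS; apply: gtd_cat.
Qed.

(* Write u = v^k t with k maximal. Dominance of u over its suffix t forces the
   infinite powers of u and v to differ for the first time inside t. *)
Lemma preceq_prefix (u v : word) :
  suffix_dominant u -> v != [::] -> v != u -> prefix v u -> preceq u v.
Proof.
move=> [_ gt_u] v_nil neq_vu /prefixP[t eq_u].
have v_gt0 : 0 < size v by rewrite lt0n size_eq0.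
have [k {}eq_u] : exists k, u = wpow v k.+1 ++ t by exists 0; rewrite wpow1.
have [m] := ubnP (size t); elim: m t k eq_u => [//|m IH] t k eq_u.
rewrite ltnS => le_t; case: (eqVneq t [::]) => [t_nil|t_nil].
  case: k eq_u => [|k]; first by rewrite t_nil wpow1 cats0 => eq_u; rewrite eq_u eqxx in neq_vu.
  (* Here [u] is a power of [v] with at least two copies, so its suffix [v] is also a prefix,
     against dominance. *)
  rewrite t_nil cats0 => eq_u; exfalso.
  have := gt_u (size (wpow v k.+1)).
  rewrite gtd_prefix; last by rewrite {1}eq_u [wpow v k.+2]wpowSr drop_size_cat // eq_u prefix_prefix.
  suff -> : 0 < size (wpow v k.+1) < size u by move/(_ isT).
  by rewrite eq_u [wpow v k.+2]wpowSr wpowS !size_cat; lia.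
have t_gt0 : 0 < size t by rewrite lt0n size_eq0.
have : gtd u t.
  have := gt_u (size (wpow v k.+1)); rewrite {3}eq_u drop_size_cat //; apply.
  by rewrite eq_u [in _ < size (_ ++ t)]size_cat wpowS size_cat; lia.
rewrite {1}eq_u wpowS -catA => /gtd_catl/orP[/prefixP[t' eq_t]|gt_vt].
  apply: (IH t' k.+1); first by rewrite eq_u eq_t catA -wpowSr.
  by apply: leq_trans le_t; rewrite eq_t size_cat -add1n leq_add2r.
apply: (@preceq_gtd _ _ k.+2).
by rewrite wpowSr eq_u gtd_cat2l.
Qed.

(** Complements [suffix_dominant_cat]: neighbours that cannot be merged are in order. By totality,
    [v] equals [u], beats [u], or is a proper prefix of [u]. *)
Lemma preceq_not_lt (u v : word) :
    suffix_dominant u -> v != [::] ->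
    ~~ (gtd u v || prefix u v && (u != v)) -> preceq u v.
Proof.
move=> dom_u v_nil; rewrite negb_or negb_and negbK => /andP[ngt_uv not_prefix].
case: (eqVneq v u) => [->|neq_vu]; first by apply/asboolP; exists 0 => b _; rewrite /lex_le lexx.
rewrite eq_sym (negPf neq_vu) orbF in not_prefix.
have := gtd_total u v; rewrite (negPf ngt_uv) (negPf not_prefix) /=.
case/orP=> [gt_vu|]; last exact: preceq_prefix.
by apply: (@preceq_gtd _ _ 1); rewrite wpow1.
Qed.

Lemma lyndon_factorization_exists (w : word) : exists ls, lyndon_factorization w ls.
Proof.
suff [ls [dom_ls sorted_ls <-]] : exists ls : seq word,
    [/\ forall l, l \in ls -> suffix_dominant l, sorted preceq ls & flatten ls = w].
  exists ls; split=> //; apply/allP=> l /dom_ls; exact: suffix_dominant_lyndon.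
elim: w => [|a w [ls [dom_ls sorted_ls <-]]]; first by exists [::].
rewrite -cat1s.
have dom_a : suffix_dominant [:: a] by split=> // i /=; lia.
(* The new letter is generalized to any dominant block: it absorbs the next factor while
   [suffix_dominant_cat] applies, and otherwise stays in front of it by [preceq_not_lt]. *)
move: {a w} [:: a] dom_a => l.
elim: ls l dom_ls sorted_ls => [|m ls IH] l dom_ls sorted_ls dom_l.
  exists [:: l]; split=> //= m; rewrite inE => /eqP-> //.
have dom_m : suffix_dominant m by apply: dom_ls; rewrite mem_head.
have dom_ls' k : k \in ls -> suffix_dominant k.
  by move=> k_ls; apply: dom_ls; rewrite inE k_ls orbT.
case: (boolP (gtd l m || prefix l m && (l != m))) => [lt_lm|nlt_lm].
  rewrite /= catA; apply: IH => //; last exact: suffix_dominant_cat.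
  exact: path_sorted sorted_ls.
exists [:: l, m & ls]; split=> //=.
  by move=> k; rewrite inE => /orP[/eqP->//|]; apply: dom_ls.
by rewrite andbC -[path _ _ _]/(sorted preceq (m :: ls)) sorted_ls; apply: preceq_not_lt => //; case: dom_m.
Qed.

(** [size_singles] holds for every Lyndon factorization, and existence guarantees that [xget]
    returns one. *)
Lemma single_singles (w : word) : single w = size (singles w).
Proof.
have [ls fact_w] := lyndon_factorization_exists w.
by rewrite (size_singles (xgetI [::] fact_w)).
Qed.

(** * The transducer and its statistics *)

Definition state : Type := word * seq (word * nat).

Definition valid (r : nat) (st : state) : bool :=
  [&& sorted leq st.1, all (fun x => x <= r) st.1 & all (marked_niw r) st.2].

Definition weight (st : state) : nat := size st.1 + \sum_(p <- st.2) size p.1.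

(* For st = encode u this says that a is a decrease in a :: u. *)
Definition falls (a : nat) (st : state) : bool :=
  has (fun x => x < a) st.1 || (if st.2 is p :: _ then head 0 p.1 < a else false).

Definition push (a : nat) (st : state) : state :=
  if ~~ falls a st then (a :: st.1, st.2)
  else if has (fun x => x < a) st.1 then
    ([seq x <- st.1 | a <= x], (a.-1 :: rev [seq x <- st.1 | x < a], 1) :: st.2)
  else if st.2 is p :: s then (st.1, (a.-1 :: p.1, p.2.+1) :: s)
  else st.

(* Inverse of push; the value on the empty state is junk. *)
Definition pop (st : state) : nat * state :=
  let: (h, s) := st in
  if (h != [::]) && (if s is p :: _ then head 0 h <= head 0 p.1 else true) then
    (head 0 h, (behead h, s))
  else if s is (c :: x, i) :: s' then
    (c.+1, if i == 1 then (rev x ++ h, s') else (h, (x, i.-1) :: s'))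
  else (0, st).

Definition encode (w : word) : state := foldr push ([::], [::]) w.

Fixpoint decode (n : nat) (st : state) : word :=
  if n is n'.+1 then (pop st).1 :: decode n' (pop st).2 else [::].

(** A letter [d] that falls is stored as [d - 1], any other as [d]; the strict test against [a] thus
    means [d <= a] or [d < a] respectively, as in the recursion of [decr]. *)
Lemma falls_push (a d : nat) (st : state) :
  falls a (push d st) = (d < a) || (d == a) && falls d st.
Proof.
case: st => h s; rewrite /push /falls /=.
case: (boolP (has (fun x => x < d) h)) => /= [/hasP[y y_h lt_yd]|nhas_d].
  have : has (fun x => x < a) [seq x <- h | d <= x] -> d < a.
    by case/hasP=> x; rewrite mem_filter => /andP[? _]; apply: leq_ltn_trans.
  by case: has => [/(_ isT)|_]; lia.
have has_a : has (fun x => x < a) h -> d < a.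
  case/hasP=> x x_h; have := hasPn nhas_d x x_h; rewrite -leqNgt.
  exact: leq_ltn_trans.
case: s => [|[x i] s] /=.
  by move: has_a; case: has => [/(_ isT)|_]; lia.
case: ifP => lt_xd /=; rewrite ?(negPf nhas_d) /=;
  by move: has_a; case: has => [/(_ isT)|_]; lia.
Qed.

Lemma decr_falls (a : nat) (u : word) : decr a u = falls a (encode u).
Proof. by elim: u a => //= b u IH a; rewrite falls_push IH. Qed.

Lemma encode_singles (w : word) : (encode w).1 = singles w.
Proof.
elim: w => //= a w <-; rewrite decr_falls /push.
case: (boolP (falls a _)) => //= _; case: ifP => //= /negbT nhas.
have -> : [seq x <- (encode w).1 | a <= x] = (encode w).1.
  by apply/all_filterP; rewrite -all_predC in nhas; apply: sub_all nhas => x /=; rewrite -leqNgt.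
by case: (encode w) => h [|p s].
Qed.

Lemma encode_dec (w : word) : \sum_(p <- (encode w).2) p.2 = dec w.
Proof.
elim: w => [|a w IH]; first by rewrite dec_nil big_nil.
rewrite dec_cons -IH decr_falls /= /push.
case: (boolP (falls a _)) => //=; case: (encode w) => h s; rewrite /falls /=.
case: ifP => /= _; first by rewrite big_cons.
by case: s => //= p s _; rewrite !big_cons.
Qed.

Lemma perm_filter_lt_ge (a : nat) (h : word) :
  perm_eq ([seq x <- h | x < a] ++ [seq x <- h | a <= x]) h.
Proof.
rewrite (@eq_filter _ (leq a) (predC (fun x => x < a))) ?perm_filterC //.
by move=> x /=; rewrite leqNgt.
Qed.

(** A falling letter [a] puts [a - 1] into a word and the missing unit into a mark; the letters of
    [h] are only moved. *)
Lemma encode_tot (w : word) :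
  \sum_(p <- (encode w).2) p.2 + tot (encode w).1 + \sum_(p <- (encode w).2) tot p.1 = tot w.
Proof.
elim: w => [|a w]; rewrite /tot /=; first by rewrite !big_nil.
move=> <-; rewrite /push; case: (encode w) => h s.
case: (boolP (falls a _)) => /=; last by lia.
rewrite /falls /=; case: ifP => [/hasP[x _ lt_xa] _|_ /=].
  rewrite !big_cons /= sumn_rev -(perm_sumn (perm_filter_lt_ge a h)) sumn_cat.
  lia.
by case: s => //= p s lt_pa; rewrite !big_cons /=; lia.
Qed.

Lemma weight_push (a : nat) (st : state) : weight (push a st) = (weight st).+1.
Proof.
case: st => h s; rewrite /push /weight.
case: (boolP (falls a _)) => //=; rewrite /falls /=; case: ifP => [_ _|_ /=].
  rewrite !big_cons /= size_rev -(perm_size (perm_filter_lt_ge a h)) size_cat.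
  by rewrite addSn addnS addnA (addnC (size [seq x <- h | a <= x])).
by case: s => //= p s lt_pa; rewrite !big_cons /=; lia.
Qed.

Lemma sorted_filter_lt_ge (a : nat) (h : word) :
  sorted leq h -> [seq x <- h | x < a] ++ [seq x <- h | a <= x] = h.
Proof.
elim: h => [//|b h IH] /= path_h; rewrite (leqNgt a b).
case: ltnP => /= [_|le_ab]; first by rewrite IH // (path_sorted path_h).
have ge_h : all (leq a) h.
  apply: sub_all (order_path_min leq_trans path_h) => x; exact: leq_trans.
rewrite (all_filterP ge_h) -[RHS]cat0s; congr (_ ++ _).
by apply/eqP; rewrite -[_ == _]negbK -has_filter -all_predC; apply: sub_all ge_h => x /=; rewrite -leqNgt.
Qed.

(** A fresh marked word has at least two letters because some letter of [h] is below [a]; in an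
    extended one, mark and length both grow by one. Storing [a - 1] keeps the words nonincreasing
    with letters below [r]. *)
Lemma valid_push (r a : nat) (st : state) :
  a <= r -> valid r st -> valid r (push a st).
Proof.
move=> le_ar; case: st => h s /and3P[/= sort_h le_h mark_s]; rewrite /push.
case: (boolP (falls a _)); rewrite /falls /=; last first.
  rewrite negb_or -all_predC => /andP[ge_h _].
  rewrite /valid /= le_ar le_h mark_s path_sortedE ?sort_h ?andbT; last exact: leq_trans.
  by apply: sub_all ge_h => x /=; rewrite -leqNgt.
case: ifP => /= [has_h _|_].
  rewrite /valid /= mark_s (sorted_filter leq_trans) // all_filter /=.
  rewrite (sub_all _ le_h); last by move=> x /= ->; rewrite implybT.
  rewrite /marked_niw /niw /= size_rev size_filter -has_count has_h all_rev.
  have lt_h : all (fun x => x < a) [seq x <- h | x < a] by apply: filter_all.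
  have a_gt0 : 0 < a by case/hasP: has_h => x _; apply: leq_trans.
  rewrite path_sortedE; last by move=> x y z; rewrite /geq /= => ? ?; lia.
  rewrite all_rev rev_sorted (sorted_filter leq_trans) // !andbT.
  rewrite ltnS -has_count has_h andbT; apply/and3P; split; last 1 first.
  - by apply: sub_all lt_h => x /leq_trans; apply.
  - by apply: sub_all lt_h => x /= ?; lia.
  - lia.
case: s mark_s => [//|[x i] s] /= /andP[mark_x mark_s] lt_xa.
rewrite /valid /= sort_h le_h mark_s /= andbT.
case/and4P: mark_x => /= /andP[sort_x lt_x] size_x i_gt0 le_i.
rewrite /marked_niw /niw /=; case: x sort_x lt_x size_x le_i lt_xa => //= b x.
by move=> -> /andP[-> ->] /=; rewrite /geq /=; lia.
Qed.

(** * Inverting the transducer *)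

Lemma head_ge (a : nat) (h : word) :
  0 < a -> all (leq a) h -> (h != [::]) && (head 0 h <= a.-1) = false.
Proof. by case: h => //= b h a_gt0 /andP[le_ab _]; lia. Qed.

(** After a falling step the rest of [h] is at least [a], so [pop] turns to the marked word headed
    by [a - 1]. Its mark is 1 exactly when the word is fresh, since an extension raises a positive
    mark. *)
Lemma pop_push (r a : nat) (st : state) : valid r st -> pop (push a st) = (a, st).
Proof.
case: st => h s /and3P[/= sort_h _ mark_s]; rewrite /push.
case: (boolP (falls a _)); rewrite /falls /=; last first.
  by rewrite negb_or; case: s mark_s => //= p s _ /andP[_]; rewrite -leqNgt => ->.
case: ifP => /= [has_h _|/negbT nhas_h].
  have a_gt0 : 0 < a by case/hasP: has_h => x _; apply: leq_trans.
  by rewrite head_ge ?filter_all // revK sorted_filter_lt_ge // prednK.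
case: s mark_s => [//|[x i] s] /= /andP[/and4P[_ _ /= i_gt0 _] _] lt_xa.
have a_gt0 : 0 < a by apply: leq_trans lt_xa.
rewrite head_ge //; first by rewrite prednK // eqSS eqn0Ngt i_gt0.
by rewrite -all_predC in nhas_h; apply: sub_all nhas_h => y /=; rewrite -leqNgt.
Qed.

Lemma push_pop (r : nat) (st : state) :
    valid r st -> 0 < weight st ->
  [/\ (pop st).1 <= r, valid r (pop st).2 & push (pop st).1 (pop st).2 = st].
Proof.
case: st => h s /and3P[/= sort_h le_h mark_s] wt_st.
case: ifP => [/andP[]|].
  case: h sort_h le_h {wt_st} => //= a h path_h /andP[le_ar le_h] _ le_as; split=> //.
    by rewrite /valid /= (path_sorted path_h) le_h.
  have ge_h := order_path_min leq_trans path_h.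
  rewrite /push; suff -> : falls a (h, s) = false by [].
  rewrite /falls /=; apply/norP; split.
    by rewrite -all_predC; apply: sub_all ge_h => x /=; rewrite -leqNgt.
  by case: s le_as {mark_s} => //= p s; rewrite -leqNgt.
case: s mark_s wt_st => [|[[|c x] i] s] mark_s wt_st.
- by case: h wt_st {sort_h le_h} => //; rewrite /weight big_nil.
- by case/andP: mark_s => /and4P[].
move: mark_s => /= /andP[/and4P[/= /andP[path_x /= /andP[lt_cr lt_x]] size_x i_gt0 le_i] mark_s] lt_ch.
(* [pop] has not chosen [h], so its least letter, if any, exceeds [c]. *)
have ge_ch : all (leq c.+1) h.
  case: h sort_h lt_ch {le_h wt_st} => //= b h path_h lt_cb.
  rewrite ltnNge lt_cb /=.
  apply: sub_all (order_path_min leq_trans path_h) => y; apply: leq_trans.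
  by rewrite ltnNge lt_cb.
have nhas_h : has (fun y => y < c.+1) h = false.
  by apply/negbTE; rewrite -all_predC; apply: sub_all ge_ch => y /=; rewrite -leqNgt.
case: eqP => [eq_i|neq_i] /=.
  (* Mark 1 means that [x] returns to [h]. Its letters are at most [c], so they are exactly those
     that [push c.+1] collects again. *)
  subst i; have le_xc : all (geq c) x.
    by rewrite (order_path_min _ path_x) // => ? ? ? /=; rewrite /geq /= => ? ?; lia.
  have le_revx : all (fun y => y < c.+1) (rev x) by rewrite all_rev.
  have has_x : has (fun y => y < c.+1) (rev x).
    by case: x size_x le_xc {path_x lt_x le_i le_revx wt_st} => //= d x _ /andP[le_dc _]; rewrite has_rev /= ltnS le_dc.
  split=> //.
    rewrite /valid /= mark_s andbT all_cat le_h all_rev andbT; apply/andP; split; last first.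
      by apply: sub_all lt_x => y /= ?; lia.
    rewrite (sorted_pairwise leq_trans) pairwise_cat -!(sorted_pairwise leq_trans) sort_h.
    rewrite rev_sorted (path_sorted path_x) !andbT; apply/allrelP => y z y_x z_h.
    by apply: leq_trans (allP ge_ch _ z_h); apply: ltnW; apply: (allP le_revx).
  rewrite /push /falls /= has_cat has_x /= !filter_cat.
  rewrite (all_filterP le_revx) (all_filterP ge_ch).
  have -> : [seq y <- h | y < c.+1] = [::] by apply/eqP; rewrite -[_ == _]negbK -has_filter nhas_h.
  have -> : [seq y <- rev x | c < y] = [::].
    apply/eqP; rewrite -[_ == _]negbK -has_filter -all_predC.
    by apply: sub_all le_revx => y /=; rewrite -leqNgt.
  by rewrite cats0 revK.
(* The mark is at least 2 and at most the length of [x], so [x] still has two letters and [i.-1] is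
   a legal mark for it. *)
split=> //.
  rewrite /valid /= sort_h le_h mark_s andbT /marked_niw /niw /=.
  by rewrite (path_sorted path_x) lt_x; lia.
rewrite /push /falls /= nhas_h /=.
have -> : head 0 x < c.+1.
  by case: x path_x {lt_x size_x le_i wt_st} => //= d x /andP[].
by rewrite /= prednK.
Qed.

(** * From states to the bijection *)

Definition reverse_singles (st : state) : state := (rev st.1, st.2).

Lemma reverse_singlesK : involutive reverse_singles.
Proof. by case=> h s; rewrite /reverse_singles /= revK. Qed.

(** States list [h] in increasing order while [w0] is nonincreasing; reversal is the only difference
    between the two encodings. *)
Lemma valid_Dstar (r n : nat) (st : state) :
  valid r st && (weight st == n) =
  [&& niw r.+1 (reverse_singles st).1, all (marked_niw r) (reverse_singles st).2
    & size (reverse_singles st).1 + \sum_(p <- (reverse_singles st).2) size p.1 == n].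
Proof. by rewrite /niw /= rev_sorted all_rev size_rev /valid -!andbA. Qed.

Lemma encode_valid (r : nat) (w : word) : all (fun x => x <= r) w -> valid r (encode w).
Proof. by elim: w => //= a w IH /andP[le_ar /IH]; apply: valid_push. Qed.

Lemma encode_weight (w : word) : weight (encode w) = size w.
Proof.
by elim: w => [|a w IH]; rewrite /= ?weight_push ?IH // /weight big_nil.
Qed.

Lemma encodeK (r : nat) (w : word) :
  all (fun x => x <= r) w -> decode (size w) (encode w) = w.
Proof.
elim: w => //= a w IH /andP[_ le_w].
by rewrite (pop_push _ (encode_valid le_w)) IH.
Qed.

Lemma weight0 (r : nat) (st : state) : valid r st -> weight st = 0 -> st = ([::], [::]).
Proof.
case: st => [[|a h] [|[[|c x] i] s]] // /and3P[_ _ /=]; rewrite /weight ?big_cons //=.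
Qed.

Lemma decodeK (r n : nat) (st : state) :
    valid r st -> weight st = n ->
  [/\ size (decode n st) = n, all (fun x => x <= r) (decode n st) & encode (decode n st) = st].
Proof.
elim: n st => [|n IH] st val_st wt_st; first by rewrite (weight0 val_st wt_st).
have [|le_pop val_pop pushK] := push_pop val_st; first by rewrite wt_st.
have wt_pop : weight (pop st).2 = n by move: wt_st; rewrite -{1}pushK weight_push => -[].
have [sz_d all_d enc_d] := IH _ val_pop wt_pop.
by split; rewrite /= ?sz_d ?le_pop ?all_d // enc_d.
Qed.

Theorem theorem2p1 (r n : nat) :
  exists phi : Dstar r n -> words r n,
    bijective phi /\
    forall d : Dstar r n,
      let w0 := (sval d).1 in
      let s := (sval d).2 in
      let w := sval (phi d) in
      [/\ \sum_(p <- s) p.2 = dec w,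
          \sum_(p <- s) p.2 + tot w0 + \sum_(p <- s) tot p.1 = tot w
        & size w0 = single w].
Proof.
have DstarP (d : Dstar r n) :
    valid r (reverse_singles (sval d)) && (weight (reverse_singles (sval d)) == n).
  by rewrite valid_Dstar reverse_singlesK (valP d).
have phiP (d : Dstar r n) :
    (size (decode n (reverse_singles (sval d))) == n)
      && all (fun x => x <= r) (decode n (reverse_singles (sval d))).
  by have /andP[val_d /eqP wt_d] := DstarP d; have [-> ->] := decodeK val_d wt_d; rewrite eqxx.
have psiP (w : words r n) :
    [&& niw r.+1 (reverse_singles (encode (sval w))).1,
        all (marked_niw r) (reverse_singles (encode (sval w))).2
      & size (reverse_singles (encode (sval w))).1
          + \sum_(p <- (reverse_singles (encode (sval w))).2) size p.1 == n].
  have /andP[/eqP sz_w le_w] := valP w.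
  by rewrite -valid_Dstar encode_valid // encode_weight sz_w eqxx.
pose phi d : words r n :=
  exist (fun w : word => (size w == n) && all (fun x => x <= r) w) _ (phiP d).
(* The three statistics are known for [encode], so they are transferred to [phi] through this
   equation. *)
have encode_phi d : encode (sval (phi d)) = reverse_singles (sval d).
  by have /andP[val_d /eqP wt_d] := DstarP d; have [] := decodeK val_d wt_d.
exists phi; split.
  pose psi (w : words r n) : Dstar r n :=
    exist (fun d : word * seq (word * nat) => [&& niw r.+1 d.1, all (marked_niw r) d.2
        & size d.1 + \sum_(p <- d.2) size p.1 == n])
      (reverse_singles (encode (sval w))) (psiP w).
  exists psi => [d|w]; apply: val_inj => /=.
    by rewrite encode_phi reverse_singlesK.
  have /andP[/eqP sz_w le_w] := valP w.
  by rewrite reverse_singlesK -{1}sz_w (encodeK le_w).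
move=> d w0 s w; have enc_w : encode w = reverse_singles (sval d) := encode_phi d.
rewrite -(encode_dec w) -(encode_tot w) single_singles -encode_singles enc_w /=.
by rewrite size_rev /tot sumn_rev.
Qed.
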